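(* Let $\mathcal D\subset\mathbb R$ and let $Q(x|\phi)$ be a family of model probability densities on $\mathcal D$ parametrized by $\phi\in\mathcal D_\phi\subset\mathbb R$. Let $P(x)$ be a probability density on $\mathcal D$, and let $\tilde\phi$ be the moment projection estimator built from $M$ independent samples drawn from $P$. Assume that $\log Q(x|\phi)$ is twice continuously differentiable in $\phi$, that the expectations of its first and second derivatives exist under $P(x)$, and that the minimizer $\phi_*$ of $\phi\mapsto D_{\mathrm{KL}}(P(x)\|Q(x|\phi))$ is unique and lies in the interior of $\mathcal D_\phi$. Let $\phi_0$ be a hidden target parameter such that $$P(x)=Q(x|\phi_0)+h(x),$$ where the deviation $h$ is small in the $1$-norm $\|h\|_1=\int_{\mathcal D}|h(x)|\,dx$. Assume furthermore that $\partial_\phi^2 D_{\mathrm{KL}}(P(x)\|Q(x|\phi))>0$ for $\phi\in[\phi_*,\phi_0]$. Then for $M\to\infty$ the asymptotic bias $|\phi_0-\phi_*|$ and the asymptotic variance $\epsilon_*^2/M$ of $\tilde\phi$ satisfy $$|\phi_0-\phi_*|=\left|\frac{\int_{\mathcal D}h(x)\,[\partial_\phi\log Q(x|\phi)]_{\phi=\phi_0}\,dx}{\mathcal I_0}\right|+O(\|h\|_1^2)\le \|h\|_1\,\frac{\max_{x\in\mathcal D}\big|[\partial_\phi\log Q(x|\phi)]_{\phi=\phi_0}\big|}{\mathcal I_0}+O(\|h\|_1^2),$$ $$\epsilon_*^2=\frac1{\mathcal I_0}+O(\|h\|_1),$$ where $$\mathcal I_0=\int_{\mathcal D}Q(x|\phi_0)\,[\partial_\phi\log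 Q(x|\phi)]^2_{\phi=\phi_0}\,dx$$ is the Fisher information of $Q(x|\phi)$ at $\phi=\phi_0$.
   Context: Moment projection estimator: given $M$ independent samples $\{x_j\}_{j=1}^M$ from $P$, $\tilde\phi=\operatorname{arg\,max}_{\phi\in\mathcal D_\phi}\ell(\phi|\{x_j\})$ with $\ell(\phi|\{x_j\})=\frac1M\sum_j\log Q(x_j|\phi)$. $D_{\mathrm{KL}}(P(x)\|Q(x|\phi))=\int_{\mathcal D}P(x)\log\frac{P(x)}{Q(x|\phi)}\,dx$. The asymptotic quantities are $\phi_*=\lim_{M\to\infty}\mathbb E[\tilde\phi]=\operatorname{arg\,min}_\phi D_{\mathrm{KL}}(P(x)\|Q(x|\phi))=\operatorname{arg\,max}_\phi\int_{\mathcal D}P(x)\log Q(x|\phi)\,dx$ and $$\epsilon_*^2=\lim_{M\to\infty}M\operatorname{Var}[\tilde\phi]=\frac{\int_{\mathcal D}P(x)\,[\partial_\phi\log Q(x|\phi)]_{\phi=\phi_*}^2\,dx}{\left(\int_{\mathcal D}P(x)\,[\partial_\phi^2\log Q(x|\phi)]_{\phi=\phi_*}\,dx\right)^2}.$$ The $O(\cdot)$ terms refer to $\|h\|_1\to0$ with the model family $Q$ and $\phi_0$ fixed.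
   Formalization: The formal theorem additionally assumes that the second derivative of log Q(x|φ) in φ is bounded uniformly in x for φ near φ_0 (and that the max of the score at φ_0 is finite); without such a bound, smallness of h in the 1-norm does not give the stated O-terms. *)

(* Defs.v *)
From HB Require Import structures.
From mathcomp Require Import all_boot all_order all_algebra.
From mathcomp Require Import all_classical all_reals all_analysis.

Set Implicit Arguments.
Unset Strict Implicit.
Unset Printing Implicit Defensive.

Import Order.TTheory GRing.Theory Num.Theory.
Import numFieldNormedType.Exports.

Local Open Scope classical_set_scope.
Local Open Scope ring_scope.

(** Derivatives relative to a set of parameters: the difference quotient only
    uses points of [A], so that derivatives at a point of [A] that is not
    interior are one-sided and values outside of [A] are irrelevant.  At an
    interior point of [A] these are the usual derivatives. *)

Definition diff_quot (R : realType) (f : R -> R) (x y : R) : R :=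
  (f y - f x) / (y - x).

Definition derivable_in (R : realType) (A : set R) (f : R -> R) (x : R) : Prop :=
  cvg (diff_quot f x y @[y --> within A x^']).

Definition derive_in (R : realType) (A : set R) (f : R -> R) (x : R) : R :=
  lim (diff_quot f x y @[y --> within A x^']).

Definition derive2_in (R : realType) (A : set R) (f : R -> R) : R -> R :=
  derive_in A (derive_in A f).

Definition twice_derivable_in (R : realType) (A : set R) (f : R -> R) (x : R) : Prop :=
  (\forall y \near within A (nbhs x), derivable_in A f y) /\
  derivable_in A (derive_in A f) x.

Definition C2_in (R : realType) (A : set R) (f : R -> R) : Prop :=
  (forall x, A x -> twice_derivable_in A f x) /\
  {within A, continuous (derive2_in A f)}.

(* The points between [a] and [b], in either order. *)
Definition segment (R : realType) (a b : R) : set R :=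
  [set t | Num.min a b <= t <= Num.max a b].

Definition density (R : realType) (D : set R) (f : R -> R) : Prop :=
  [/\ measurable_fun D f,
      (forall x, D x -> 0 <= f x) &
      (\int[lebesgue_measure]_(x in D) (f x)%:E = 1)%E].

Definition norm1 (R : realType) (D : set R) (h : R -> R) : R :=
  \int[lebesgue_measure]_(x in D) `|h x|.

(* Existence of the expectation of [g] under the density [P]. *)
Definition expectation_exists (R : realType) (D : set R) (P g : R -> R) : Prop :=
  (@lebesgue_measure R).-integrable D (fun x => (P x * g x)%:E).

(* [Q x phi] stands for Q(x|phi); positivity is what makes log Q meaningful. *)
Definition density_family (R : realType) (D Dphi : set R) (Q : R -> R -> R) : Prop :=
  forall phi, Dphi phi ->
    density D (Q ^~ phi) /\ (forall x, D x -> 0 < Q x phi).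

Definition score (R : realType) (Dphi : set R) (Q : R -> R -> R) (x phi : R) : R :=
  derive_in Dphi (fun t => ln (Q x t)) phi.

Definition dscore (R : realType) (Dphi : set R) (Q : R -> R -> R) (x phi : R) : R :=
  derive2_in Dphi (fun t => ln (Q x t)) phi.

(* The integrand has an integrable negative part when [P] and [Q] are
   densities, so this is the usual divergence, possibly [+oo]; the points with
   [P x = 0] contribute 0. *)
Definition KL (R : realType) (D : set R) (P : R -> R) (Q : R -> R -> R) (phi : R)
    : \bar R :=
  (\int[lebesgue_measure]_(x in D) (P x * ln (P x / Q x phi))%:E)%E.

Definition unique_minimizer (R : realType) (A : set R) (F : R -> \bar R) (a : R) : Prop :=
  A a /\ forall t, A t -> t <> a -> (F a < F t)%E.

(* F''(t) exists and is positive; F is required to be finite near t within A,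
   so that [fine] loses nothing. *)
Definition second_derivative_gt0 (R : realType) (A : set R) (F : R -> \bar R) (t : R)
    : Prop :=
  [/\ (\forall s \near within A (nbhs t), F s \is a fin_num),
      twice_derivable_in A (fine \o F) t &
      0 < derive2_in A (fine \o F) t].

Definition fisher_information (R : realType) (D Dphi : set R) (Q : R -> R -> R)
    (phi0 : R) : R :=
  \int[lebesgue_measure]_(x in D) (Q x phi0 * score Dphi Q x phi0 ^+ 2).

(* The asymptotic (in the number M of samples) value of M times the variance
   of the estimator. *)
Definition eps2 (R : realType) (D Dphi : set R) (Q : R -> R -> R) (P : R -> R)
    (phis : R) : R :=
  (\int[lebesgue_measure]_(x in D) (P x * score Dphi Q x phis ^+ 2)) /
  (\int[lebesgue_measure]_(x in D) (P x * dscore Dphi Q x phis)) ^+ 2.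

(* An infinite sequence of mutually independent samples with density [P];
   independence of finite subfamilies is obtained by taking some of the [B i]
   to be the full set. *)
Definition iid_samples (R : realType) (D : set R) (P : R -> R)
    (d : measure_display) (Omega : measurableType d) (Pr : probability Omega R)
    (X : nat -> {RV Pr >-> R}) : Prop :=
  (forall i (B : set R), measurable B ->
     (Pr (X i @^-1` B) = \int[lebesgue_measure]_(x in D `&` B) (P x)%:E)%E) /\
  (forall n (B : nat -> set R), (forall i, measurable (B i)) ->
     (Pr (\bigcap_(i in [set i | (i < n)%N]) (X i @^-1` B i))
       = \prod_(i < n) Pr (X i @^-1` B i))%E).

Definition log_likelihood (R : realType) (Q : R -> R -> R) (M : nat) (x : nat -> R)
    (phi : R) : R :=
  M%:R^-1 * \sum_(j < M) ln (Q (x j) phi).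

(* [est M] is the estimator built from the first [M] samples. *)
Definition moment_projection_estimator (R : realType) (D Dphi : set R)
    (Q : R -> R -> R) (P : R -> R)
    (d : measure_display) (Omega : measurableType d) (Pr : probability Omega R)
    (X est : nat -> {RV Pr >-> R}) : Prop :=
  iid_samples D P X /\
  forall M, (0 < M)%N -> {ae Pr, forall w,
    Dphi (est M w) /\
    forall phi, Dphi phi ->
      log_likelihood Q M (fun j => X j w) phi
        <= log_likelihood Q M (fun j => X j w) (est M w)}.

(* The bias and variance estimates for the limiting mean [a] and the limiting
   rescaled variance [v] of the estimator, with [C] the constant of all the
   O-terms and [h] the deviation. *)
Definition bias_variance_bounds (R : realType) (D Dphi : set R)
    (Q : R -> R -> R) (phi0 : R) (h : R -> R) (C a v : R) : Prop :=
  let I0 := fisher_information D Dphi Q phi0 in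
  let s0 := fun x => score Dphi Q x phi0 in
  [/\ `| `|phi0 - a|
         - `| (\int[lebesgue_measure]_(x in D) (h x * s0 x)) / I0 | |
        <= C * norm1 D h ^+ 2,
      `|phi0 - a| <= norm1 D h * (sup [set `|s0 x| | x in D] / I0)
                     + C * norm1 D h ^+ 2 &
      `|v - I0^-1| <= C * norm1 D h].

(* Main.v *)
Require Import Defs.
From HB Require Import structures.
From mathcomp Require Import all_boot all_order all_algebra.
From mathcomp Require Import all_classical all_reals all_analysis.
From mathcomp Require Import measurable_realfun ring lra.

(* Write s(x, phi) for the score, d = phis - phi0 and n for the 1-norm of h.  Near
   phi0 the divergence has derivative - \int P s(., phi) in phi, which increases
   strictly along the segment and vanishes at phis.  Since Q(., phi) has mass 1,
   s(., phi) has mean 0 under Q(., phi), and therefore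
     \int P s(., phi) = \int h s(., phi0) - (phi - phi0) I0
                         + O((phi - phi0)^2 + |phi - phi0| n).
   The sign of this expression at phi0 - r and phi0 + r confines phis to a fixed
   neighbourhood of phi0; evaluated at phis it gives first d = O(n) and then the
   expansion of the bias.  Dividing the mean-zero relation between two nearby
   parameters by their distance and using dominated convergence yields
   \int Q(., phi) s'(., phi) = - I(phi), where the Fisher information I is
   Lipschitz, so only second derivatives of log Q are needed for the variance. *)

Set Implicit Arguments.
Unset Strict Implicit.
Unset Printing Implicit Defensive.

Import Order.TTheory GRing.Theory Num.Theory.
Import numFieldNormedType.Exports.

Local Open Scope classical_set_scope.
Local Open Scope ring_scope.

(** * Calculus with derivatives relative to a parameter set *)

Section derive_in_calculus.
Context {R : realType}.
Implicit Types (A : set R) (f : R -> R).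

Lemma derive_in_near A f x : derivable_in A f x -> forall e, 0 < e ->
  exists2 d, 0 < d & forall y, A y -> y != x -> `|y - x| < d ->
    `|diff_quot f x y - derive_in A f x| < e.
Proof.
move=> /cvgrPdist_lt dfx e e0; have := dfx _ e0.
rewrite near_withinE => /nbhs_ballP[d /= d0 dP]; exists d => // y Ay yx yd.
by rewrite distrC; apply: dP => //=; rewrite /ball /= distrC.
Qed.

Lemma derivable_in_lipschitz A f x : derivable_in A f x ->
  exists L d, 0 < d /\
    forall y, A y -> `|y - x| < d -> `|f y - f x| <= L * `|y - x|.
Proof.
move=> /derive_in_near /(_ 1 ltr01)[d d0 dP].
exists (`|derive_in A f x| + 1), d; split=> // y Ay yd.
have [->|yx] := eqVneq y x; first by rewrite !subrr normr0 mulr0.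
have -> : f y - f x = diff_quot f x y * (y - x).
  by rewrite /diff_quot divfK// subr_eq0.
rewrite normrM ler_wpM2r//; have := dP y Ay yx yd.
have := ler_normD (diff_quot f x y - derive_in A f x) (derive_in A f x).
rewrite subrK; lra.
Qed.

Lemma is_derive_derive_in A f x : nbhs x A -> derivable_in A f x ->
  is_derive x 1 f (derive_in A f x).
Proof.
move=> /nbhs_ballP[r /= r0 rA] /derive_in_near dP.
have H : h^-1 *: ((f \o shift x) (h *: 1) - f x) @[h --> 0^'] -->
    derive_in A f x.
  apply/cvgrPdist_lt => e e0; have [d d0 {}dP] := dP e e0.
  exists (Num.min r d) => /=; first by rewrite lt_min r0.
  move=> h /=; rewrite sub0r normrN lt_min => /andP[hr hd] h0.
  have := dP (h + x); rewrite /diff_quot addrK => {}dP.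
  rewrite distrC /shift/= /GRing.scale/= mulr1 [_^-1 * _]mulrC; apply: dP => //.
    by apply: rA; rewrite /ball /= opprD addrCA subrr addr0 normrN.
  by rewrite -subr_eq0 addrK.
split; first by apply/cvg_ex; exists (derive_in A f x); exact: H.
by apply: cvg_lim => //; exact: H.
Qed.

(** Points of []a, b[] are interior to [A], where relative and ordinary derivatives agree. The
    endpoints may lie on the boundary of [A]; there the local Lipschitz bound still gives the
    continuity within [[a, b]] that the ordinary mean value theorem asks for. *)
Lemma MVT_in A f a b : a < b -> `[a, b] `<=` A ->
  (forall t, t \in `[a, b] -> derivable_in A f t) ->
  exists2 c, c \in `]a, b[ & f b - f a = derive_in A f c * (b - a).
Proof.
move=> ab abA df; apply: MVT => //.
  move=> x xab; apply: is_derive_derive_in.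
    apply: filterS (near_in_itvoo xab) => y yab; apply: abA.
    exact: subset_itv_oo_cc yab.
  exact/df/subset_itv_oo_cc.
apply/subspace_continuousP => x xab.
have [L [d [d0 Lip]]] := derivable_in_lipschitz (df _ xab).
apply/cvgrPdist_lt => e e0; rewrite near_withinE; apply/nbhs_ballP.
have L0 : 0 < `|L| + 1 by rewrite ltr_wpDl.
exists (Num.min d (e / (`|L| + 1))) => /=; first by rewrite lt_min d0 divr_gt0.
move=> y; rewrite /ball /= lt_min distrC => /andP[yd ye] yab.
rewrite distrC; apply: le_lt_trans (Lip y (abA _ yab) yd) _.
move: ye; rewrite ltr_pdivlMr//; have := ler_norm L; have := normr_ge0 (y - x).
nra.
Qed.

Lemma MVT_in_norm A f a b : `[Num.min a b, Num.max a b] `<=` A ->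
  (forall t, t \in `[Num.min a b, Num.max a b] -> derivable_in A f t) ->
  exists2 c, c \in `[Num.min a b, Num.max a b] &
    f b - f a = derive_in A f c * (b - a).
Proof.
have [ab abA df|ba abA df|-> _ _] := ltgtP a b.
- by have [c /subset_itv_oo_cc cab ->] := MVT_in ab abA df; exists c.
- have [c /subset_itv_oo_cc cab E] := MVT_in ba abA df; exists c => //.
  by rewrite -[LHS]opprB E; ring.
- by exists b; rewrite ?in_itv/= ?lexx// !subrr mulr0.
Qed.

(** Relative derivatives are evaluated along this sequence, because dominated convergence and
    measurability of limits need countable limits. The denominator [n.+1] keeps every term between
    [x] and [c]. *)
Definition approach (x c : R) (n : nat) : R := x + (c - x) / n.+1%:R.

Lemma approach_neq x c n : c != x -> approach x c n != x.
Proof.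
move=> cx; rewrite /approach -subr_eq0 addrAC subrr add0r.
by rewrite mulf_neq0// ?invr_eq0 ?pnatr_eq0// subr_eq0.
Qed.

Lemma approach_itv a b x c n : x \in `[a, b] -> c \in `[a, b] ->
  approach x c n \in `[a, b].
Proof.
rewrite !in_itv/= /approach => /andP[ax xb] /andP[ac cb].
have t0 : 0 <= n.+1%:R^-1 :> R by rewrite invr_ge0.
have t1 : n.+1%:R^-1 <= 1 :> R by rewrite invf_le1// ler1n.
set t := _^-1 in t0 t1 *; by apply/andP; split; nra.
Qed.

Lemma approach_cvg x c : approach x c @ \oo --> x.
Proof.
rewrite -[X in _ --> X]addr0 -[X in _ + X](mulr0 (c - x)).
apply: cvgD; first exact: cvg_cst.
by apply: cvgM; [exact: cvg_cst|exact: cvg_harmonic].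
Qed.

Lemma derive_in_cvg_seq A f x (u : nat -> R) : derivable_in A f x ->
  (forall n, A (u n)) -> (forall n, u n != x) -> u @ \oo --> x ->
  diff_quot f x (u n) @[n --> \oo] --> derive_in A f x.
Proof.
move=> /derive_in_near dP uA ux /cvgrPdist_lt u_x; apply/cvgrPdist_lt => e e0.
have [d d0 {}dP] := dP e e0; near=> n; rewrite distrC; apply: dP => //.
by rewrite distrC; near: n; exact: u_x.
Unshelve. all: by end_near. Qed.

(** An error linear in the step vanishes in the limit. With [w] constantly 0 this shows [q = 0]. *)
Lemma eq_of_approach (w : nat -> R) (q l K x c : R) :
  w @ \oo --> l -> (forall n, `|w n - q| <= K * `|approach x c n - x|) ->
  q = l.
Proof.
move=> wl wq; apply/eqP; rewrite eq_sym -subr_eq0 -normr_le0.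
have H1 : `|w n - q| @[n --> \oo] --> `|l - q|.
  by apply: cvg_norm; apply: cvgB => //; exact: cvg_cst.
have H2 : K * `|approach x c n - x| @[n --> \oo] --> K * `|x - x|.
  apply: cvgM; first exact: cvg_cst.
  by apply: cvg_norm; apply: cvgB; [exact: approach_cvg|exact: cvg_cst].
rewrite subrr normr0 mulr0 in H2.
apply: (ler_cvg_to H1 H2); exact: nearW.
Qed.

End derive_in_calculus.

(** * Elementary bounds on the exponential near 0 *)

Section expR_bounds.
Context {R : realType}.

(** The inequality [1 + v <= expR v] at [u] bounds from below; at [- u] it gives
    [(1 - u) * expR u <= 1], and [(1 - u) * (1 + u + 2 * u ^+ 2) >= 1] for [u <= 1/2]. *)
Lemma expR_sub1D_bound (u : R) : `|u| <= 2^-1 -> `|expR u - 1 - u| <= 2 * u ^+ 2.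
Proof.
rewrite ler_norml => /andP[u1 u2].
have H1 := expR_ge1Dx u; have H2 := expR_ge1Dx (- u); have H0 := expR_gt0 u.
rewrite expRN in H2.
have H3 : (1 - u) * expR u <= 1.
  by rewrite -ler_pdivlMr// div1r.
rewrite ger0_norm; last by lra.
have : (1 - u) * (1 + u + 2 * u ^+ 2 - expR u) >= 0.
  have -> : (1 - u) * (1 + u + 2 * u ^+ 2 - expR u) =
     (1 - (1 - u) * expR u) + u ^+ 2 * (1 - 2 * u) by ring.
  apply: addr_ge0; first by rewrite subr_ge0.
  by apply: mulr_ge0; [exact: sqr_ge0|lra].
rewrite pmulr_rge0; lra.
Qed.

Lemma expR_sub1_bound (u : R) : `|u| <= 2^-1 -> `|expR u - 1| <= 2 * `|u|.
Proof.
move=> uh; have := expR_sub1D_bound uh.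
have := ler_normD (expR u - 1 - u) u; rewrite subrK.
rewrite -real_normK ?num_real//; have := normr_ge0 u; nra.
Qed.

End expR_bounds.

(** * Integrals against a probability density *)

Section density_integrals.
Context disp {X : measurableType disp} {R : realType} (mu : {measure set X -> \bar R})
  (D : set X) (mD : measurable D).
Implicit Types (w f u : X -> R).

Definition mdensity w : Prop :=
  [/\ measurable_fun D w, (forall x, D x -> 0 <= w x) &
      (\int[mu]_(x in D) (w x)%:E = 1)%E].

Lemma integrable_mul_bounded w u B : mu.-integrable D (EFin \o w) ->
  measurable_fun D u -> (forall x, D x -> `|u x| <= B) ->
  mu.-integrable D (EFin \o (fun x => w x * u x)).
Proof.
move=> iw mfu uB; have mw := measurable_int mu iw.
apply: (@le_integrable _ _ _ mu D mD _ (fun x => B%:E * (EFin \o w) x)%E).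
- by apply/measurable_EFinP; apply: measurable_funM => //; exact/measurable_EFinP.
- move=> x Dx /=; rewrite lee_fin !normrM mulrC ler_wpM2r//.
  by rewrite (le_trans (uB x Dx))// ler_norm.
- exact: integrableZl.
Qed.

Lemma le_normr_Rintegral_mul w u B : mu.-integrable D (EFin \o w) ->
  measurable_fun D u -> (forall x, D x -> `|u x| <= B) ->
  `|\int[mu]_(x in D) (w x * u x)| <= B * \int[mu]_(x in D) `|w x|.
Proof.
move=> iw mfu uB; have iwu := integrable_mul_bounded iw mfu uB.
have inw : mu.-integrable D (EFin \o (fun x => `|w x|)).
  exact: (integrable_norm iw).
have -> : B * \int[mu]_(x in D) `|w x| = \int[mu]_(x in D) (B * `|w x|).
  by rewrite RintegralZl.
apply: le_trans (le_normr_Rintegral mD iwu) _; apply: le_Rintegral => //.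
- exact: (integrable_norm iwu).
- exact: (@integrableZl _ _ _ mu D mD B (EFin \o (fun x => `|w x|)) inw).
- by move=> x Dx; rewrite normrM mulrC ler_wpM2r// uB.
Qed.

Lemma density_integrable w : mdensity w -> mu.-integrable D (EFin \o w).
Proof.
move=> [mw w0 w1]; apply/integrableP; split; first exact/measurable_EFinP.
rewrite (eq_integral (fun x => (w x)%:E)) ?w1 ?ltry// => x /set_mem Dx.
by rewrite /= ger0_norm ?w0.
Qed.

Lemma density_Rintegral w : mdensity w -> \int[mu]_(x in D) w x = 1.
Proof. by case=> _ _ w1; rewrite /Rintegral w1. Qed.

Lemma integrable_le_density w f B : mdensity w -> measurable_fun D f ->
  (forall x, D x -> `|f x| <= B * w x) -> mu.-integrable D (EFin \o f).
Proof.
move=> dw mf fB; have iw := density_integrable dw.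
apply: (@le_integrable _ _ _ mu D mD _ (fun x => B%:E * (EFin \o w) x)%E).
- exact/measurable_EFinP.
- by move=> x Dx /=; rewrite lee_fin (le_trans (fB x Dx))// ler_norm.
- exact: integrableZl.
Qed.

Lemma Rintegral_le_density w f B : mdensity w -> measurable_fun D f ->
  (forall x, D x -> `|f x| <= B * w x) -> `|\int[mu]_(x in D) f x| <= B.
Proof.
move=> dw mf fB; have iw := density_integrable dw.
have jf := integrable_le_density dw mf fB.
apply: le_trans (le_normr_Rintegral mD jf) _.
rewrite -[leRHS]mulr1 -(density_Rintegral dw) -RintegralZl//.
apply: le_Rintegral => //; first exact: (integrable_norm jf).
exact: (@integrableZl _ _ _ mu D mD B (EFin \o w)).
Qed.

Lemma cvg_Rintegral_mul w (u_ : nat -> X -> R) u B : mu.-integrable D (EFin \o w) ->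
  (forall n, measurable_fun D (u_ n)) ->
  (forall n x, D x -> `|u_ n x| <= B) ->
  (forall x, D x -> u_ n x @[n --> \oo] --> u x) ->
  \int[mu]_(x in D) (w x * u_ n x) @[n --> \oo] --> \int[mu]_(x in D) (w x * u x).
Proof.
move=> iw mu_ uB u_u.
have mfu : measurable_fun D u by exact: (measurable_fun_cvg mu_ u_u).
have mw : measurable_fun D w by apply/measurable_EFinP; exact: measurable_int iw.
have inw := integrable_norm iw.
have lB x : D x -> `|u x| <= B.
  move=> Dx; apply: (ler_cvg_to (cvg_norm (u_u x Dx)) (cvg_cst B)).
  by apply: nearW => n; exact: uB.
apply: fine_cvg; rewrite fineK; last first.
  exact: (integrable_fin_num mD (integrable_mul_bounded iw mfu lB)).
have [] // := @dominated_convergence _ _ _ mu D mD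
  (fun n x => (w x * u_ n x)%:E) (fun x => (w x * u x)%:E)
  (fun x => (B%:E * (`|w x|%R)%:E)%E).
- by move=> n; apply/measurable_EFinP; exact: measurable_funM.
- by apply/measurable_EFinP; exact: measurable_funM.
- apply: aeW => x Dx; apply: cvg_EFin; first exact: nearW.
  by apply: cvgM; [exact: cvg_cst|exact: u_u].
- exact: (integrableZl mD B inw).
- apply: aeW => x n Dx; rewrite -EFinM /= lee_fin normrM mulrC ler_wpM2r//.
  exact: uB.
Qed.

End density_integrals.

(** * A family of densities near a parameter *)

(* The score, its derivative and the divergence of [Defs] over an arbitrary
   measure space: [lebesgue_measure] lives on a type whose measurable structure
   is convertible, but not syntactically equal, to the canonical one of [R]. *)
Definition log_deriv (X : Type) (R : realType) (A : set R) (Q : X -> R -> R)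
    (x : X) (phi : R) : R :=
  derive_in A (fun t => ln (Q x t)) phi.

Definition log_deriv2 (X : Type) (R : realType) (A : set R) (Q : X -> R -> R)
    (x : X) (phi : R) : R :=
  derive2_in A (fun t => ln (Q x t)) phi.

Definition divergence disp (X : measurableType disp) (R : realType)
    (mu : {measure set X -> \bar R}) (D : set X) (P : X -> R) (Q : X -> R -> R)
    (phi : R) : \bar R :=
  (\int[mu]_(x in D) (P x * ln (P x / Q x phi))%:E)%E.

(* [Tab] keeps every log-ratio ln (Q x psi / Q x phi) on [[a, b]] below 1/2. *)
Section local_family.
Context disp {X : measurableType disp} {R : realType} (mu : {measure set X -> \bar R})
  (D : set X) (Dphi : set R) (Q : X -> R -> R) (a b T : R).
Notation s := (log_deriv Dphi Q).
Notation ds := (log_deriv2 Dphi Q).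
Context (mD : measurable D)
  (famQ : forall phi, Dphi phi ->
    mdensity mu D (Q ^~ phi) /\ (forall x, D x -> 0 < Q x phi))
  (C2Q : forall x, D x -> C2_in Dphi (fun phi => ln (Q x phi)))
  (ab : a < b) (abD : `[a, b] `<=` Dphi) (T1 : 1 <= T)
  (Tab : 2 * T * (b - a) <= 1)
  (sT : forall x t, D x -> t \in `[a, b] -> `|s x t| <= T)
  (dsT : forall x t, D x -> t \in `[a, b] -> `|ds x t| <= T).
Implicit Types (x : X) (phi psi : R).

(** * Pointwise Lipschitz and Taylor bounds for the score, the log-density and the density *)

Lemma itv_between phi psi : phi \in `[a, b] -> psi \in `[a, b] ->
  {subset `[Num.min phi psi, Num.max phi psi] <= `[a, b]}.
Proof.
rewrite !in_itv/= => /andP[? ?] /andP[? ?] t; rewrite !in_itv/= ge_min le_max.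
by move=> /andP[/orP[?|?] /orP[?|?]]; apply/andP; split; lra.
Qed.

Lemma norm_between phi psi t : t \in `[Num.min phi psi, Num.max phi psi] ->
  `|t - phi| <= `|psi - phi|.
Proof.
rewrite in_itv/=; have [?|?|->] := ltgtP phi psi => /andP[? ?].
- by rewrite !ger0_norm; lra.
- by rewrite !ler0_norm; lra.
- by rewrite (_ : t = psi)//; lra.
Qed.

Lemma log_derivable x phi : D x -> phi \in `[a, b] ->
  derivable_in Dphi (fun t => ln (Q x t)) phi.
Proof.
move=> Dx pab; have [/(_ phi (abD pab))[+ _] _] := C2Q Dx.
rewrite near_withinE => /nbhs_singleton; apply; exact: abD.
Qed.

Lemma score_derivable x phi : D x -> phi \in `[a, b] ->
  derivable_in Dphi (s x) phi.
Proof. by move=> Dx pab; have [/(_ phi (abD pab))[_]] := C2Q Dx. Qed.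

Lemma score_lipschitz x phi psi : D x -> phi \in `[a, b] -> psi \in `[a, b] ->
  `|s x psi - s x phi| <= T * `|psi - phi|.
Proof.
move=> Dx pab qab; have sub := itv_between pab qab.
have [t /sub tab|t /sub tab|c /sub cab ->] := @MVT_in_norm _ Dphi (s x) phi psi.
- exact: abD.
- exact: score_derivable.
- by rewrite normrM ler_wpM2r//; exact: dsT.
Qed.

Lemma log_taylor x phi psi : D x -> phi \in `[a, b] -> psi \in `[a, b] ->
  `|ln (Q x psi) - ln (Q x phi) - (psi - phi) * s x phi| <= T * (psi - phi) ^+ 2.
Proof.
move=> Dx pab qab; have sub := itv_between pab qab.
have [t /sub tab|t /sub tab|c cpq E] :=
    @MVT_in_norm _ Dphi (fun t => ln (Q x t)) phi psi.
- exact: abD.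
- exact: log_derivable.
- rewrite /= -/(s x c) in E; rewrite E [X in `|X - _|]mulrC -mulrBr normrM.
  rewrite -[X in T * X]real_normK ?num_real//.
  have := score_lipschitz Dx pab (sub _ cpq); have := norm_between cpq.
  have := normr_ge0 (psi - phi).
  set u := `|psi - phi|; set v := `|c - phi|; set z := `|s x c - _|.
  move=> u0 vu zv; rewrite expr2 mulrA [leRHS]mulrC ler_wpM2l//.
  by rewrite (le_trans zv)// ler_wpM2l// (le_trans _ T1).
Qed.

Lemma log_lipschitz x phi psi : D x -> phi \in `[a, b] -> psi \in `[a, b] ->
  `|ln (Q x psi) - ln (Q x phi)| <= T * `|psi - phi|.
Proof.
move=> Dx pab qab; have sub := itv_between pab qab.
have [t /sub tab|t /sub tab|c cpq ->] :=
    @MVT_in_norm _ Dphi (fun t => ln (Q x t)) phi psi.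
- exact: abD.
- exact: log_derivable.
- by rewrite normrM ler_wpM2r//; apply: sT => //; exact: sub.
Qed.

Lemma itv_dist phi psi : phi \in `[a, b] -> psi \in `[a, b] ->
  `|psi - phi| <= b - a.
Proof. by rewrite !in_itv/= ler_norml => /andP[? ?] /andP[? ?]; lra. Qed.

Lemma Q_gt0 x phi : D x -> phi \in `[a, b] -> 0 < Q x phi.
Proof. by move=> Dx pab; have [_] := famQ (abD pab); exact. Qed.

Lemma Q_density phi : phi \in `[a, b] -> mdensity mu D (Q ^~ phi).
Proof. by move=> pab; have [] := famQ (abD pab). Qed.

(** Through this form, bounds on log-ratios become bounds on [Q] with an error proportional to
    [Q x phi], which has mass 1, so they integrate over any [D]. *)
Lemma Q_ratio x phi psi : D x -> phi \in `[a, b] -> psi \in `[a, b] ->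
  Q x psi = Q x phi * expR (ln (Q x psi) - ln (Q x phi)).
Proof.
move=> Dx pab qab; rewrite expRD expRN !lnK ?posrE ?Q_gt0//.
by rewrite mulrCA divff ?mulr1// gt_eqF// Q_gt0.
Qed.

Lemma log_ratio_small x phi psi : D x -> phi \in `[a, b] -> psi \in `[a, b] ->
  `|ln (Q x psi) - ln (Q x phi)| <= 2^-1.
Proof.
move=> Dx pab qab; apply: le_trans (log_lipschitz Dx pab qab) _.
have := itv_dist pab qab; have := normr_ge0 (psi - phi); have := T1; have := Tab.
by set u := `|_|; nra.
Qed.

Lemma Q_lipschitz x phi psi : D x -> phi \in `[a, b] -> psi \in `[a, b] ->
  `|Q x psi - Q x phi| <= 2 * T * `|psi - phi| * Q x phi.
Proof.
move=> Dx pab qab; rewrite (Q_ratio Dx pab qab).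
rewrite -[X in `|_ - X|]mulr1 -mulrBr normrM mulrC.
rewrite (gtr0_norm (Q_gt0 Dx pab)) ler_wpM2r ?(ltW (Q_gt0 Dx pab))//.
apply: le_trans (expR_sub1_bound (log_ratio_small Dx pab qab)) _.
by rewrite -mulrA ler_wpM2l// log_lipschitz.
Qed.

(** The exponential remainder contributes [2 * T ^+ 2] and the Taylor remainder of the logarithm
    [T], at most [T ^+ 2] since [1 <= T]. *)
Lemma Q_taylor x phi psi : D x -> phi \in `[a, b] -> psi \in `[a, b] ->
  `|Q x psi - Q x phi - (psi - phi) * s x phi * Q x phi|
    <= 3 * T ^+ 2 * (psi - phi) ^+ 2 * Q x phi.
Proof.
move=> Dx pab qab; rewrite (Q_ratio Dx pab qab).
have := expR_sub1D_bound (log_ratio_small Dx pab qab).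
have := log_taylor Dx pab qab; have := log_lipschitz Dx pab qab.
set u := ln (Q x psi) - _; set q := Q x phi; set d := psi - phi => H1 H2 H3.
have -> : q * expR u - q - d * s x phi * q =
  (expR u - 1 - u + (u - d * s x phi)) * q by ring.
rewrite normrM (gtr0_norm (Q_gt0 Dx pab)) ler_wpM2r ?(ltW (Q_gt0 Dx pab))//.
apply: le_trans (ler_normD _ _) _.
have u2 : u ^+ 2 <= T ^+ 2 * d ^+ 2.
  rewrite -exprMn -(real_normK (num_real u)) -(real_normK (num_real (T * d))).
  rewrite lerXn2r ?nnegrE// normrM (ger0_norm (le_trans ler01 T1))//.
have := sqr_ge0 d; have := T1; nra.
Qed.

(** * Measurability in the sample variable *)

Lemma measurable_Q phi : phi \in `[a, b] -> measurable_fun D (Q ^~ phi).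
Proof. by move=> /Q_density[]. Qed.

Lemma itv_other phi : phi \in `[a, b] -> exists2 c, c \in `[a, b] & c != phi.
Proof.
move=> pab; have [pa|ap] := eqVneq a phi.
  by exists b; rewrite ?in_itv/= ?lexx ?andbT ?ltW// -pa gt_eqF.
by exists a; rewrite // in_itv/= lexx ltW.
Qed.

(** The score is the pointwise limit of a sequence of difference quotients of [ln (Q x _)], each
    measurable in [x]. *)
Lemma measurable_score phi : phi \in `[a, b] -> measurable_fun D (s ^~ phi).
Proof.
move=> pab; have [c cab cp] := itv_other pab.
pose u := approach phi c.
have uab n : u n \in `[a, b] by exact: approach_itv.
apply: (@measurable_fun_cvg _ _ _ D
  (fun n x => diff_quot (fun t => ln (Q x t)) phi (u n))) => [n|x Dx].
- apply: measurable_funM => //; apply: measurable_funB;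
    apply: measurableT_comp => //; exact: measurable_Q.
- apply: derive_in_cvg_seq; first exact: log_derivable.
  + by move=> n; exact/abD/uab.
  + by move=> n; exact: approach_neq.
  + exact: approach_cvg.
Qed.

Lemma measurable_dscore phi : phi \in `[a, b] -> measurable_fun D (ds ^~ phi).
Proof.
move=> pab; have [c cab cp] := itv_other pab.
pose u := approach phi c.
have uab n : u n \in `[a, b] by exact: approach_itv.
apply: (@measurable_fun_cvg _ _ _ D
  (fun n x => diff_quot (s x) phi (u n))) => [n|x Dx].
- by apply: measurable_funM => //; apply: measurable_funB; exact: measurable_score.
- apply: derive_in_cvg_seq; first exact: score_derivable.
  + by move=> n; exact/abD/uab.
  + by move=> n; exact: approach_neq.
  + exact: approach_cvg.
Qed.

(** * Fisher information and the means of the score and its derivative *)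

Notation I phi := (\int[mu]_(x in D) (Q x phi * s x phi ^+ 2)).

Lemma Q_integrable phi : phi \in `[a, b] -> mu.-integrable D (EFin \o (Q ^~ phi)).
Proof. by move=> pab; exact/density_integrable/Q_density. Qed.

Lemma integrable_mul_score w phi : mu.-integrable D (EFin \o w) ->
  phi \in `[a, b] -> mu.-integrable D (EFin \o (fun x => w x * s x phi)).
Proof.
move=> iw pab; apply: (@integrable_mul_bounded _ _ _ _ _ mD _ _ T) => //.
  exact: measurable_score.
by move=> x Dx; exact: sT.
Qed.

Lemma integrable_mul_dscore w phi : mu.-integrable D (EFin \o w) ->
  phi \in `[a, b] -> mu.-integrable D (EFin \o (fun x => w x * ds x phi)).
Proof.
move=> iw pab; apply: (@integrable_mul_bounded _ _ _ _ _ mD _ _ T) => //.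
  exact: measurable_dscore.
by move=> x Dx; exact: dsT.
Qed.

Lemma score2_bound x phi : D x -> phi \in `[a, b] -> `|s x phi ^+ 2| <= T ^+ 2.
Proof.
by move=> Dx pab; rewrite normrX lerXn2r ?nnegrE ?sT// (le_trans ler01 T1).
Qed.

Lemma integrable_mul_score2 w phi : mu.-integrable D (EFin \o w) ->
  phi \in `[a, b] -> mu.-integrable D (EFin \o (fun x => w x * s x phi ^+ 2)).
Proof.
move=> iw pab; apply: (@integrable_mul_bounded _ _ _ _ _ mD _ _ (T ^+ 2)) => //.
  by apply: measurable_funX; exact: measurable_score.
by move=> x Dx; exact: score2_bound.
Qed.

Lemma measurable_weighted w : mu.-integrable D (EFin \o w) -> measurable_fun D w.
Proof. by move=> iw; apply/measurable_EFinP; exact: measurable_int iw. Qed.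

(** Integrating [Q_taylor], where both densities have mass 1, bounds [psi - phi] times the mean by a
    multiple of [(psi - phi) ^+ 2]; dividing and letting [psi] tend to [phi] leaves 0. *)
Lemma score_mean0 phi : phi \in `[a, b] ->
  \int[mu]_(x in D) (Q x phi * s x phi) = 0.
Proof.
move=> pab; have [c cab cp] := itv_other pab.
apply: (@eq_of_approach _ (fun=> 0) _ 0 (3 * T ^+ 2) phi c (cvg_cst _)) => n.
have := approach_neq n cp; have := approach_itv n pab cab.
move: (approach phi c n) => psi qab qp.
have iq := Q_integrable qab; have ip := Q_integrable pab.
have is_ := integrable_mul_score ip pab.
have iZ := integrableZl mD (psi - phi) is_.
set q := Rintegral _ _ _.
have : `|\int[mu]_(x in D)
    (Q x psi - Q x phi - (psi - phi) * (Q x phi * s x phi))|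
    <= 3 * T ^+ 2 * (psi - phi) ^+ 2.
  apply: (Rintegral_le_density mD (Q_density pab)).
    apply: measurable_funB; first by apply: measurable_funB; exact: measurable_weighted.
    exact: (measurable_weighted iZ).
  by move=> x Dx; rewrite [Q x phi * _]mulrC mulrA; exact: Q_taylor.
rewrite RintegralB//; last exact: (integrableB mD iq ip).
rewrite RintegralB// RintegralZl// -/q !density_Rintegral; [|exact: Q_density..].
rewrite subrr !sub0r !normrN normrM -(real_normK (num_real (psi - phi))).
have : 0 < `|psi - phi| by rewrite normr_gt0 subr_eq0.
set e := `|psi - phi| => e0.
by rewrite [e ^+ 2]expr2 mulrA [leRHS]mulrC ler_pM2l.
Qed.

(* This uses no modulus of continuity of the second log-derivative: since the
   score has mean 0 at every parameter, the mean of [s x psi] under [Q x phi] is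
   its integral against [Q x phi - Q x psi]. *)
Lemma score_mean_shift phi psi : phi \in `[a, b] -> psi \in `[a, b] ->
  `|\int[mu]_(x in D) (Q x phi * s x psi) + (psi - phi) * I phi|
    <= 4 * T ^+ 3 * (psi - phi) ^+ 2.
Proof.
move=> pab qab; have iq := Q_integrable qab; have ip := Q_integrable pab.
have i1 := integrable_mul_score ip qab.
have i2 := integrable_mul_score2 ip pab.
have i3 := integrable_mul_score iq qab.
have iZ := integrableZl mD (psi - phi) i2.
have -> : \int[mu]_(x in D) (Q x phi * s x psi) + (psi - phi) * I phi =
  \int[mu]_(x in D) (Q x phi * s x psi + (psi - phi) * (Q x phi * s x phi ^+ 2)
     - Q x psi * s x psi).
  rewrite RintegralB//; last exact: (integrableD mD i1 iZ).
  by rewrite RintegralD// RintegralZl// score_mean0// subr0.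
apply: (Rintegral_le_density mD (Q_density pab)).
  apply: measurable_funB; last exact: (measurable_weighted i3).
  apply: measurable_funD; first exact: (measurable_weighted i1).
  exact: (measurable_weighted iZ).
move=> x Dx; have H1 := Q_taylor Dx pab qab; have H2 := sT Dx qab.
have H3 := sT Dx pab; have H4 := score_lipschitz Dx pab qab.
have q0 := Q_gt0 Dx pab.
(* The first product carries the Taylor remainder of [Q], the second two factors of first order in
   [psi - phi]. Together they cost [3 * T ^+ 3 + T ^+ 2], at most [4 * T ^+ 3]. *)
have -> : Q x phi * s x psi + (psi - phi) * (Q x phi * s x phi ^+ 2) -
    Q x psi * s x psi =
  - ((Q x psi - Q x phi - (psi - phi) * s x phi * Q x phi) * s x psi)
  - (psi - phi) * Q x phi * s x phi * (s x psi - s x phi) by ring.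
apply: le_trans (ler_normB _ _) _; rewrite normrN !normrM (gtr0_norm q0).
apply: (@le_trans _ _ (
   3 * T ^+ 2 * (psi - phi) ^+ 2 * Q x phi * T +
   `|psi - phi| * Q x phi * T * (T * `|psi - phi|))); last first.
  rewrite -(real_normK (num_real (psi - phi))) -subr_ge0.
  move: `|psi - phi| (Q x phi) q0 => e q q0; rewrite [leRHS](_ : _ =
    T ^+ 2 * e ^+ 2 * q * (T - 1)); last by ring.
  by rewrite mulr_ge0 ?subr_ge0// mulr_ge0 ?(ltW q0)// mulr_ge0// sqr_ge0.
apply: lerD; first exact: ler_pM.
apply: ler_pM => //; last by rewrite ler_wpM2l// mulr_ge0// ltW.
by rewrite !mulr_ge0// ltW.
Qed.

(** As [s x phi] has mean 0, the mean of the difference quotient of the score is the mean of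
    [s x psi] divided by [psi - phi], which [score_mean_shift] puts near [- I phi]. Dominated
    convergence, with bound [T] from [score_lipschitz], identifies the limit. *)
Lemma dscore_mean phi : phi \in `[a, b] ->
  \int[mu]_(x in D) (Q x phi * ds x phi) = - I phi.
Proof.
move=> pab; have [c cab cp] := itv_other pab; apply/esym.
have uab n : approach phi c n \in `[a, b] by exact: approach_itv.
have ip := Q_integrable pab.
apply: (@eq_of_approach _ (fun n =>
  \int[mu]_(x in D) (Q x phi * diff_quot (s x) phi (approach phi c n)))
  _ _ (4 * T ^+ 3) phi c).
- apply: (@cvg_Rintegral_mul _ _ _ _ _ mD _ _ _ T) => //.
  + move=> n; apply: measurable_funM => //.
    by apply: measurable_funB; exact: measurable_score.
  + move=> n x Dx; rewrite /diff_quot normrM normfV.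
    rewrite ler_pdivrMr ?normr_gt0 ?subr_eq0 ?approach_neq//.
    exact: score_lipschitz.
  + move=> x Dx; apply: derive_in_cvg_seq; first exact: score_derivable.
    * by move=> n; exact/abD/uab.
    * by move=> n; exact: approach_neq.
    * exact: approach_cvg.
move=> n; have := score_mean_shift pab (uab n).
have := approach_neq n cp; have := uab n.
move: (approach phi c n) => psi qab qp H.
have i1 := integrable_mul_score ip qab; have i2 := integrable_mul_score ip pab.
have -> : \int[mu]_(x in D) (Q x phi * diff_quot (s x) phi psi) =
  (psi - phi)^-1 * \int[mu]_(x in D) (Q x phi * s x psi).
  rewrite -[RHS]subr0 -[X in _ - X](mulr0 (psi - phi)^-1) -(score_mean0 pab).
  rewrite -mulrBr -RintegralB// -RintegralZl//; last exact: (integrableB mD i1 i2).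
  by apply: eq_Rintegral => x _; rewrite /diff_quot; ring.
have d0 : psi - phi != 0 by rewrite subr_eq0.
rewrite opprK.
set q := Rintegral _ _ _ in H *; set J := Rintegral _ _ _ in H *.
have -> : (psi - phi)^-1 * q + J = (psi - phi)^-1 * (q + (psi - phi) * J).
  by rewrite mulrDr mulKf.
rewrite normrM normfV mulrC ler_pdivrMr ?normr_gt0//.
by apply: le_trans H _; rewrite -(real_normK (num_real (psi - phi))) expr2 mulrA.
Qed.

(** * Means under the perturbed density *)

Section perturbation.
Context (phi0 : R) (P h : X -> R).
Context (p0 : phi0 \in `[a, b]) (dP : mdensity mu D P)
  (hP : forall x, D x -> P x = Q x phi0 + h x).
Implicit Types u : X -> R.
Notation h1 := (\int[mu]_(x in D) `|h x|).

Lemma deviation_integrable : mu.-integrable D (EFin \o h).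
Proof.
apply: (eq_integrable mD _ _ _
  (integrableB mD (density_integrable dP) (Q_integrable p0))).
by move=> x /set_mem Dx /=; rewrite hP// -EFinB addrAC subrr add0r.
Qed.

Lemma Rintegral_perturb u B : measurable_fun D u -> (forall x, D x -> `|u x| <= B) ->
  \int[mu]_(x in D) (P x * u x) =
  \int[mu]_(x in D) (Q x phi0 * u x) + \int[mu]_(x in D) (h x * u x).
Proof.
move=> mfu uB; rewrite -RintegralD//.
- by apply: eq_Rintegral => x /set_mem Dx; rewrite hP// mulrDl.
- exact: (integrable_mul_bounded mD (Q_integrable p0) mfu uB).
- exact: (integrable_mul_bounded mD deviation_integrable mfu uB).
Qed.

Lemma deviation_bound u B : measurable_fun D u -> (forall x, D x -> `|u x| <= B) ->
  `|\int[mu]_(x in D) (h x * u x)| <= B * h1.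
Proof. exact: (le_normr_Rintegral_mul mD deviation_integrable). Qed.

Lemma perturbed_score_mean phi : phi \in `[a, b] ->
  `|\int[mu]_(x in D) (P x * s x phi) - \int[mu]_(x in D) (h x * s x phi0)
    + (phi - phi0) * I phi0|
  <= 4 * T ^+ 3 * (phi - phi0) ^+ 2 + T * `|phi - phi0| * h1.
Proof.
move=> pab; rewrite (Rintegral_perturb (measurable_score pab) (B := T)); last first.
  by move=> x Dx; exact: sT.
have ih := deviation_integrable.
have -> : \int[mu]_(x in D) (Q x phi0 * s x phi) +
    \int[mu]_(x in D) (h x * s x phi) - \int[mu]_(x in D) (h x * s x phi0)
    + (phi - phi0) * I phi0 =
  (\int[mu]_(x in D) (Q x phi0 * s x phi) + (phi - phi0) * I phi0) +
  \int[mu]_(x in D) (h x * (s x phi - s x phi0)).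
  rewrite [X in _ = _ + X](_ : _ =
    \int[mu]_(x in D) (h x * s x phi - h x * s x phi0)); last first.
    by apply: eq_Rintegral => x _; rewrite mulrBr.
  rewrite RintegralB//; [|exact: integrable_mul_score..].
  have aux (u v w z : R) : u + v - w + z = u + z + (v - w) by ring.
  exact: aux.
apply: le_trans (ler_normD _ _) _; apply: lerD; first exact: score_mean_shift.
apply: deviation_bound.
  by apply: measurable_funB; exact: measurable_score.
by move=> x Dx; exact: score_lipschitz.
Qed.

(** The derivative of the score is never compared at two parameters. It stays at [phi] while the
    density moves from [Q x phi0] to [Q x phi], where [dscore_mean] gives exactly [- I phi]; then
    [I phi] is compared with [I phi0]. *)
Lemma perturbed_dscore_mean phi : phi \in `[a, b] ->
  `|\int[mu]_(x in D) (P x * ds x phi) + I phi0|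
  <= 6 * T ^+ 3 * `|phi - phi0| + T * h1.
Proof.
move=> pab; have mds := measurable_dscore pab.
rewrite (Rintegral_perturb mds (B := T)); last by move=> x Dx; exact: dsT.
have ip := Q_integrable pab; have i0 := Q_integrable p0.
have j1 := integrable_mul_dscore i0 pab; have j2 := integrable_mul_dscore ip pab.
have j3 := integrable_mul_score2 i0 p0; have j4 := integrable_mul_score2 ip pab.
rewrite addrAC; apply: le_trans (ler_normD _ _) _; apply: lerD; last first.
  by apply: deviation_bound => // x Dx; exact: dsT.
have -> : \int[mu]_(x in D) (Q x phi0 * ds x phi) + I phi0 =
  \int[mu]_(x in D) ((Q x phi0 * ds x phi - Q x phi * ds x phi) +
     (Q x phi0 * s x phi0 ^+ 2 - Q x phi * s x phi ^+ 2)).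
  rewrite RintegralD//; [|exact: (integrableB mD j1 j2)|exact: (integrableB mD j3 j4)].
  rewrite !RintegralB// dscore_mean//.
  have aux (u v w : R) : u + v = u - - w + (v - w) by ring.
  exact: aux.
apply: (Rintegral_le_density mD (Q_density p0)).
  apply: measurable_funD; apply: measurable_funB.
  - exact: (measurable_weighted j1).
  - exact: (measurable_weighted j2).
  - exact: (measurable_weighted j3).
  - exact: (measurable_weighted j4).
move=> x Dx; have q0 := Q_gt0 Dx p0; have H1 := Q_lipschitz Dx p0 pab.
have H2 := score_lipschitz Dx p0 pab; have H3 := sT Dx pab; have H4 := sT Dx p0.
have H5 := dsT Dx pab; have H6 := score2_bound Dx pab.
have -> : Q x phi0 * ds x phi - Q x phi * ds x phi +
     (Q x phi0 * s x phi0 ^+ 2 - Q x phi * s x phi ^+ 2) =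
  - ((Q x phi - Q x phi0) * (ds x phi + s x phi ^+ 2))
  - Q x phi0 * (s x phi - s x phi0) * (s x phi + s x phi0) by ring.
apply: (@le_trans _ _ (2 * T * `|phi - phi0| * Q x phi0 * (T + T ^+ 2) +
    Q x phi0 * (T * `|phi - phi0|) * (T + T))).
  apply: le_trans (ler_normB _ _) _; rewrite normrN !normrM (gtr0_norm q0).
  have T0 : 0 <= T := le_trans ler01 T1.
  apply: lerD; apply: ler_pM => //.
  - by apply: le_trans (ler_normD _ _) _; exact: lerD.
  - by rewrite mulr_ge0// ltW.
  - by rewrite ler_wpM2l// ltW.
  - by apply: le_trans (ler_normD _ _) _; exact: lerD.
move: (normr_ge0 (phi - phi0)) q0; move: `|phi - phi0| (Q x phi0) => e q e0 q0.
rewrite -subr_ge0 [leRHS](_ : _ = 4 * T ^+ 2 * e * q * (T - 1)); last by ring.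
have T0 : 0 <= T := le_trans ler01 T1.
by rewrite !mulr_ge0 ?subr_ge0// ?exprn_ge0// ltW.
Qed.

Lemma perturbed_score2_mean phi : phi \in `[a, b] ->
  `|\int[mu]_(x in D) (P x * s x phi ^+ 2) - I phi0|
  <= 2 * T ^+ 2 * `|phi - phi0| + T ^+ 2 * h1.
Proof.
move=> pab; have ms : measurable_fun D (fun x => s x phi ^+ 2).
  by apply: measurable_funX; exact: measurable_score.
rewrite (Rintegral_perturb ms (B := T ^+ 2)); last first.
  by move=> x Dx; exact: score2_bound.
have ip := Q_integrable pab; have i0 := Q_integrable p0.
have j1 := integrable_mul_score2 i0 p0; have j2 := integrable_mul_score2 i0 pab.
rewrite addrAC; apply: le_trans (ler_normD _ _) _; apply: lerD; last first.
  by apply: deviation_bound => // x Dx; exact: score2_bound.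
rewrite -RintegralB//; apply: (Rintegral_le_density mD (Q_density p0)).
  apply: measurable_funB; first exact: (measurable_weighted j2).
  exact: (measurable_weighted j1).
move=> x Dx; have q0 := Q_gt0 Dx p0.
have H2 := score_lipschitz Dx p0 pab; have H3 := sT Dx pab; have H4 := sT Dx p0.
have -> : Q x phi0 * s x phi ^+ 2 - Q x phi0 * s x phi0 ^+ 2 =
  (s x phi - s x phi0) * (s x phi + s x phi0) * Q x phi0 by ring.
rewrite 2!normrM (gtr0_norm q0) ler_wpM2r ?(ltW q0)//.
have -> : 2 * T ^+ 2 * `|phi - phi0| = (T * `|phi - phi0|) * (T + T).
  by move: `|_| => e; ring.
by apply: ler_pM => //; apply: le_trans (ler_normD _ _) _; exact: lerD.
Qed.

(** * The divergence and its derivative *)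

Notation F := (divergence mu D P Q).

Lemma KL_integrand x phi : D x -> phi \in `[a, b] ->
  P x * ln (P x / Q x phi) = P x * (ln (P x) - ln (Q x phi)).
Proof.
move=> Dx pab; have [_ /(_ x Dx) + _] := dP.
rewrite le_eqVlt => /predU1P[<-|P0]; first by rewrite !mul0r.
by rewrite ln_div ?posrE// (Q_gt0 Dx pab).
Qed.

(** The difference of two infinite parts is not finite, so a finite value leaves both the positive
    and the negative part integrable. *)
Lemma KL_integrable phi : phi \in `[a, b] -> F phi \is a fin_num ->
  mu.-integrable D (EFin \o (fun x => P x * ln (P x / Q x phi))).
Proof.
move=> pab Ffin; have [mP _ _] := dP; have [mQ _ _] := Q_density pab.
have mf : measurable_fun D (fun x => P x * ln (P x / Q x phi)).
  apply: (@eq_measurable_fun _ _ _ _ D (fun x => P x * (ln (P x) - ln (Q x phi)))).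
    by move=> x /set_mem Dx; rewrite KL_integrand.
  apply: measurable_funM => //.
  by apply: measurable_funB; exact: measurableT_comp.
apply/integrableP; split; first exact/measurable_EFinP.
by rewrite integral_fin_num_abs.
Qed.

(** The term [P x * ln (P x)] cancels pointwise, before integration, so the entropy of [P] need not
    be finite. *)
Lemma KL_sub phi psi : phi \in `[a, b] -> psi \in `[a, b] ->
  F phi \is a fin_num -> F psi \is a fin_num ->
  mu.-integrable D (EFin \o (fun x => P x * (ln (Q x psi) - ln (Q x phi)))) /\
  fine (F psi) - fine (F phi) =
  - \int[mu]_(x in D) (P x * (ln (Q x psi) - ln (Q x phi))).
Proof.
move=> pab qab Fp Fq; have ip := KL_integrable pab Fp; have iq := KL_integrable qab Fq.
have E x : D x -> P x * ln (P x / Q x phi) - P x * ln (P x / Q x psi) =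
    P x * (ln (Q x psi) - ln (Q x phi)).
  by move=> Dx; rewrite !KL_integrand//; ring.
split.
  apply: (eq_integrable mD _ _ _ (integrableB mD ip iq)).
  by move=> x /set_mem Dx /=; rewrite -EFinB E.
rewrite -[LHS]opprB; congr (- _).
rewrite -[LHS]/(Rintegral _ _ _ - Rintegral _ _ _) -RintegralB//.
by apply: eq_Rintegral => x /set_mem Dx; exact: E.
Qed.

(** Derivability is assumed, so one sequence suffices to find the value; [log_taylor], integrated
    against [P], makes the error of the difference quotient linear in the step. *)
Lemma KL_derive phi : (forall t, t \in `[a, b] -> F t \is a fin_num) ->
  phi \in `[a, b] -> derivable_in Dphi (fine \o F) phi ->
  derive_in Dphi (fine \o F) phi = - \int[mu]_(x in D) (P x * s x phi).
Proof.
move=> Ffin pab dF; have [c cab cp] := itv_other pab; apply/esym.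
have uab n : approach phi c n \in `[a, b] by exact: approach_itv.
apply: (@eq_of_approach _
  (fun n => diff_quot (fine \o F) phi (approach phi c n)) _ _ T phi c).
  apply: derive_in_cvg_seq => //.
  - by move=> n; exact/abD/uab.
  - by move=> n; exact: approach_neq.
  - exact: approach_cvg.
move=> n; have := approach_neq n cp; have := uab n.
move: (approach phi c n) => psi qab qp.
have d0 : psi - phi != 0 by rewrite subr_eq0.
have [iL EF] := KL_sub pab qab (Ffin _ pab) (Ffin _ qab).
have is_ := integrable_mul_score (density_integrable dP) pab.
have iZ := integrableZl mD (psi - phi) is_.
rewrite /diff_quot /= EF opprK.
set L := Rintegral _ _ _; set S := Rintegral _ _ _.
have -> : - L / (psi - phi) + S = - ((L - (psi - phi) * S) / (psi - phi)).
  by rewrite mulrBl [(psi - phi) * S]mulrC mulfK// opprB addrC mulNr.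
rewrite normrN normrM normfV ler_pdivrMr ?normr_gt0//.
apply: (@le_trans _ _ (T * (psi - phi) ^+ 2)); last first.
  by rewrite -(real_normK (num_real (psi - phi))) expr2 mulrA.
rewrite /L /S -RintegralZl// -RintegralB//.
apply: (Rintegral_le_density mD dP).
  apply: measurable_funB; first exact: (measurable_weighted iL).
  exact: (measurable_weighted iZ).
move=> x Dx; have [_ /(_ x Dx) P0 _] := dP.
rewrite [X in `|X|](_ : _ =
  (ln (Q x psi) - ln (Q x phi) - (psi - phi) * s x phi) * P x); last by ring.
by rewrite normrM (ger0_norm P0) ler_wpM2r//; exact: log_taylor.
Qed.

End perturbation.

End local_family.

(** * The minimizer of the divergence *)

Section minimizer.
Context {R : realType}.
Implicit Types (A : set R) (F : R -> \bar R).

Lemma derive_in_interior_min A f x : (\forall t \near x, A t /\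
    derivable_in A f t /\ f x <= f t) -> derive_in A f x = 0 :> R.
Proof.
move=> /nbhs_ballP[e /= e0 eP].
have eq2 t : t \in `]x - e / 2, x + e / 2[%R ->
    nbhs t A /\ derivable_in A f t /\ f x <= f t.
  rewrite in_itv/= => /andP[t1 t2].
  have xt : ball x e t by rewrite /ball /= ltr_norml; lra.
  split; last by have [_] := eP _ xt.
  apply/nbhs_ballP; exists (e / 2) => /=; first by rewrite divr_gt0.
  move=> y; rewrite /ball /= ltr_norml => /andP[y1 y2].
  by have [] := eP y; rewrite // /ball /= ltr_norml; lra.
have xI : x \in `]x - e / 2, x + e / 2[%R by rewrite in_itv/=; lra.
have dA : is_derive x 1 f (derive_in A f x).
  by have [? []] := eq2 _ xI; move=> *; exact: is_derive_derive_in.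
have d0 : is_derive x 1 f 0.
  apply: (@derive1_at_min _ f (x - e / 2) (x + e / 2)) => //; first by lra.
  - move=> t /eq2[tA [dt _]]; by have [] := is_derive_derive_in tA dt.
  - by move=> t /eq2[_ []].
by rewrite -(@derive_val _ _ _ _ _ _ _ dA) (@derive_val _ _ _ _ _ _ _ d0).
Qed.

(** Around [phis] there is room on both sides, but at [phi0] the set [A] may stop. Hence [phis] is
    strictly inside [[a, b]], [phi0] may be an endpoint, and the derivative is known to increase
    only on the segment, where the second derivative is positive. *)
Lemma unique_minimizer_neighborhood A F phis phi0 :
  unique_minimizer A F phis -> A° phis -> segment phis phi0 `<=` A ->
  (forall t, segment phis phi0 t -> second_derivative_gt0 A F t) ->
  exists a b, [/\ a < phis < b /\ a <= phi0 <= b, `[a, b] `<=` A,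
    forall t, t \in `[a, b] ->
      F t \is a fin_num /\ derivable_in A (fine \o F) t,
    derive_in A (fine \o F) phis = 0 &
    forall u v, segment phis phi0 u -> segment phis phi0 v -> u < v ->
      derive_in A (fine \o F) u < derive_in A (fine \o F) v].
Proof.
move=> [Aphis minF] intA segA F2.
have sphis : segment phis phi0 phis.
  by rewrite /segment /= ge_min le_max lexx.
have seg t : segment phis phi0 t ->
    F t \is a fin_num /\ derivable_in A (fine \o F) t.
  move=> st; have [H1 [H2 _] _] := F2 t st; have At := segA t st; split.
    by move: H1; rewrite near_withinE => /nbhs_singleton; exact.
  by move: H2; rewrite near_withinE => /nbhs_singleton; exact.
have [e e0 eP] : exists2 e, 0 < e & forall t, `|t - phis| < e ->
    A t /\ F t \is a fin_num /\ derivable_in A (fine \o F) t.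
  have [H1 [H2 _] _] := F2 phis sphis.
  rewrite !near_withinE in H1 H2.
  have /nbhs_ballP[e /= e0 eP] : nbhs phis (A `&`
      ([set t | A t -> F t \is a fin_num] `&`
       [set t | A t -> derivable_in A (fine \o F) t])).
    by apply: filterI => //; exact: filterI.
  exists e => // t te; have [|At [Ft dt]] := eP t; last by do !split; auto.
  by rewrite /ball /= distrC.
(* The segment is prolonged by [e / 2] around [phis], so that the closed interval stays in the union
   of the segment and the open ball of radius [e]. *)
exists (Num.min (phis - e / 2) phi0), (Num.max (phis + e / 2) phi0).
have cases t : Num.min (phis - e / 2) phi0 <= t <= Num.max (phis + e / 2) phi0 ->
    segment phis phi0 t \/ `|t - phis| < e.
  rewrite /segment /= ltr_norml !ge_min !le_max => /andP[/orP H1 /orP H2].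
  have [?|?] := ltP (t - phis) e; last first.
    by left; case: H1; case: H2 => ? ?; apply/andP; split; apply/orP; lra.
  have [?|?] := ltP (- e) (t - phis); first by right.
  by left; case: H1; case: H2 => ? ?; apply/andP; split; apply/orP; lra.
split.
- rewrite gt_min lt_max ge_min le_max lexx !orbT; split=> //.
  by apply/andP; split; apply/orP; left; lra.
- by move=> t /=; rewrite in_itv/= => /cases[/segA|/eP[]].
- by move=> t; rewrite in_itv/= => /cases[/seg|/eP[]].
- apply: derive_in_interior_min; apply/nbhs_ballP; exists e => // t.
  rewrite /ball /= distrC => /eP[At [Ft dt]]; split => //; split => //.
  have [->//|tphis] := eqVneq t phis.
  have [Fp _] := seg phis sphis.
  by rewrite fine_le// ltW// minF//; exact/eqP.
- move=> u v su sv uv.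
  have sub t : t \in `[u, v] -> segment phis phi0 t.
    move: su sv; rewrite /segment /= in_itv/= => /andP[u1 u2] /andP[v1 v2].
    by move=> /andP[t1 t2]; rewrite (le_trans u1 t1) (le_trans t2 v2).
  have [t /sub /segA//|t /sub /F2[_ []]//|c cuv E] :=
    @MVT_in _ A (derive_in A (fine \o F)) _ _ uv.
  have /F2[_ _ c0] := sub c (subset_itv_oo_cc cuv).
  by rewrite -subr_gt0 E mulr_gt0// subr_gt0.
Qed.

End minimizer.

(* [d] is the bias, [H] the mean of the score under the deviation, and [N], [E]
   are the two integrals in the asymptotic variance [N / E ^+ 2]. *)
Lemma expansion_estimates {R : realFieldType} (I0 T n d H N E : R) :
  0 < I0 -> 1 <= T -> 0 <= n ->
  4 * T ^+ 3 * `|d| + T * n <= I0 / 2 -> `|H| <= T * n ->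
  `|d * I0 - H| <= 4 * T ^+ 3 * d ^+ 2 + T * `|d| * n ->
  `|N - I0| <= 2 * T ^+ 2 * `|d| + T ^+ 2 * n ->
  `|E + I0| <= 6 * T ^+ 3 * `|d| + T * n ->
  6 * T ^+ 3 * `|d| + T * n <= I0 / 2 ->
  let C := (16 * T ^+ 5 / I0 ^+ 2 + 2 * T ^+ 2 / I0) / I0 +
     4 * (4 * T ^+ 3 / I0 + T ^+ 2 + 3 * (12 * T ^+ 4 / I0 + T)) / I0 ^+ 2 in
  `|d - H / I0| <= C * n ^+ 2 /\ `|N / E ^+ 2 - I0^-1| <= C * n.
Proof.
move=> I0p T1 n0 small Hn dH NI EI Esmall C.
have T0 : 0 <= T := le_trans ler01 T1.
(* The error in [dH] is [|d|] times a factor that is at most [I0 / 2], so half of [|d| * I0] absorbs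
   it and [|d| * I0 / 2 <= T * n] remains. *)
have dn : `|d| <= 2 * T / I0 * n.
  have : `|d * I0| <= `|d * I0 - H| + `|H|.
    by have := ler_normD (d * I0 - H) H; rewrite subrK.
  rewrite normrM (gtr0_norm I0p) mulrAC ler_pdivlMr//.
  move: dH; rewrite -(real_normK (num_real d)).
  move: `|d| (normr_ge0 d) small => e e0 small dH; nra.
have C1 : 0 <= (16 * T ^+ 5 / I0 ^+ 2 + 2 * T ^+ 2 / I0) / I0.
  by rewrite !(mulr_ge0, addr_ge0, exprn_ge0, invr_ge0)// ltW.
have C2 : 0 <= 4 * (4 * T ^+ 3 / I0 + T ^+ 2 + 3 * (12 * T ^+ 4 / I0 + T)) / I0 ^+ 2.
  by rewrite !(mulr_ge0, addr_ge0, exprn_ge0, invr_ge0)// ltW.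
split.
  apply: (@le_trans _ _ ((16 * T ^+ 5 / I0 ^+ 2 + 2 * T ^+ 2 / I0) / I0 * n ^+ 2)).
    have -> : d - H / I0 = (d * I0 - H) / I0 by field; rewrite gt_eqF.
    rewrite normrM (gtr0_norm (_ : 0 < I0^-1)) ?invr_gt0//.
    rewrite [leRHS]mulrAC ler_wpM2r ?invr_ge0 ?(ltW I0p)//.
    apply: le_trans dH _; rewrite -(real_normK (num_real d)).
    (* Inserting [dn] in both error terms produces the first summand of [C]. *)
    apply: (@le_trans _ _ (4 * T ^+ 3 * (2 * T / I0 * n) ^+ 2
       + T * (2 * T / I0 * n) * n)).
      apply: lerD.
        by rewrite ler_wpM2l ?mulr_ge0 ?exprn_ge0// lerXn2r// ?nnegrE ?(le_trans _ dn).
      by rewrite ler_wpM2r// ler_wpM2l.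
    rewrite le_eqVlt; apply/orP; left; apply/eqP; field; by rewrite gt_eqF.
  by rewrite ler_wpM2r ?exprn_ge0// lerDl.
(* [Esmall] keeps the denominator away from 0. *)
have E1 : - E >= I0 / 2 by move: EI; rewrite ler_norml => /andP[_]; lra.
have E2 : - E <= 3 * I0 / 2 by move: EI; rewrite ler_norml => /andP[+ _]; lra.
have E0 : E != 0 by rewrite -oppr_eq0 gt_eqF// (lt_le_trans _ E1)// divr_gt0.
have NI' : `|N - I0| <= (4 * T ^+ 3 / I0 + T ^+ 2) * n.
  apply: le_trans NI _; rewrite [leRHS]mulrDl lerD2r.
  have -> : 4 * T ^+ 3 / I0 * n = 2 * T ^+ 2 * (2 * T / I0 * n).
    by field; rewrite gt_eqF.
  by rewrite ler_wpM2l// mulr_ge0// exprn_ge0.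
have EI' : `|E + I0| <= (12 * T ^+ 4 / I0 + T) * n.
  apply: le_trans EI _; rewrite [leRHS]mulrDl lerD2r.
  have -> : 12 * T ^+ 4 / I0 * n = 6 * T ^+ 3 * (2 * T / I0 * n).
    by field; rewrite gt_eqF.
  by rewrite ler_wpM2l// mulr_ge0// exprn_ge0.
have En : (I0 / 2) ^+ 2 <= E ^+ 2.
  by rewrite -[E ^+ 2]sqrrN lerXn2r// ?nnegrE ?(le_trans _ E1) ?divr_ge0// ltW.
(* The numerator uses [I0 ^+ 2 - E ^+ 2 = (I0 - E) * (I0 + E)]. The factor 3 in [C] bounds
   [(I0 - E) / I0], and the factor 4 comes from [E ^+ 2 >= (I0 / 2) ^+ 2]. *)
have -> : N / E ^+ 2 - I0^-1 =
    ((N - I0) * I0 + (I0 - E) * (E + I0)) / (E ^+ 2 * I0).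
  by field; rewrite E0 gt_eqF.
have D0 : 0 < E ^+ 2 * I0 by rewrite mulr_gt0// exprn_even_gt0.
rewrite normrM normfV (gtr0_norm D0) ler_pdivrMr//.
set c1 := 4 * T ^+ 3 / I0 + T ^+ 2 in NI' C C2 *.
set c2 := 12 * T ^+ 4 / I0 + T in EI' C C2 *.
apply: (@le_trans _ _ (4 * (c1 + 3 * c2) / I0 ^+ 2 * n * ((I0 / 2) ^+ 2 * I0))).
  have -> : 4 * (c1 + 3 * c2) / I0 ^+ 2 * n * ((I0 / 2) ^+ 2 * I0) =
     c1 * n * I0 + (3 * I0) * (c2 * n) by field; rewrite gt_eqF.
  apply: le_trans (ler_normD _ _) _; rewrite !normrM (gtr0_norm I0p).
  apply: lerD; first by rewrite ler_wpM2r// ltW.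
  by apply: ler_pM => //; rewrite ger0_norm; lra.
apply: ler_pM => //.
- exact: mulr_ge0.
- by rewrite mulr_ge0 ?sqr_ge0// ltW.
- by rewrite ler_wpM2r// lerDr.
- by rewrite ler_wpM2r// ltW.
Qed.

(** * Uniform expansion of the minimizer in the deviation *)

Section minimizer_expansion.
Context disp {X : measurableType disp} {R : realType} (mu : {measure set X -> \bar R})
  (D : set X) (Dphi : set R) (Q : X -> R -> R) (phi0 : R).
Context (mD : measurable D)
  (famQ : forall phi, Dphi phi ->
    mdensity mu D (Q ^~ phi) /\ (forall x, D x -> 0 < Q x phi))
  (C2Q : forall x, D x -> C2_in Dphi (fun phi => ln (Q x phi))).
Notation s := (log_deriv Dphi Q).
Notation ds := (log_deriv2 Dphi Q).
Notation I0 := (\int[mu]_(x in D) (Q x phi0 * s x phi0 ^+ 2)).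
Notation L1 h := (\int[mu]_(x in D) `|h x|).
Implicit Types (P h : X -> R) (phis : R).

Definition minimizer_bounds C P h phis : Prop :=
  [/\ `| `|phi0 - phis| - `|(\int[mu]_(x in D) (h x * s x phi0)) / I0| |
        <= C * L1 h ^+ 2,
      `|phi0 - phis|
        <= L1 h * (sup [set `|s x phi0| | x in D] / I0)
           + C * L1 h ^+ 2 &
      `|(\int[mu]_(x in D) (P x * s x phis ^+ 2)) /
        (\int[mu]_(x in D) (P x * ds x phis)) ^+ 2 - I0^-1|
        <= C * L1 h].

Lemma local_score_bound (a b S K : R) : phi0 \in `[a, b] -> `[a, b] `<=` Dphi ->
  b - a <= 1 -> 0 <= K -> (forall x, D x -> `|s x phi0| <= S) ->
  (forall x t, D x -> t \in `[a, b] -> `|ds x t| <= K) ->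
  forall x t, D x -> t \in `[a, b] -> `|s x t| <= S + K.
Proof.
move=> p0 abD ba1 K0 sS dsK x t Dx tab.
have := score_lipschitz C2Q abD dsK Dx p0 tab; have := sS x Dx.
have := itv_dist p0 tab; have := ler_normD (s x t - s x phi0) (s x phi0).
rewrite subrK; have := normr_ge0 (t - phi0); nra.
Qed.

(** Since [Q x phi0] is positive, zero Fisher information forces the score at [phi0] to vanish
    almost everywhere on [D]. This serves the degenerate case of the expansion. *)
Lemma fisher_eq0 (a b T : R) P u : phi0 \in `[a, b] -> a < b -> `[a, b] `<=` Dphi ->
  1 <= T -> (forall x t, D x -> t \in `[a, b] -> `|s x t| <= T) ->
  mdensity mu D P -> measurable_fun D u ->
  I0 = 0 -> \int[mu]_(x in D) (P x * (s x phi0 * u x)) = 0.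
Proof.
move=> p0 ab abD T1 sT [mP _ _] mfu I00; have ms := measurable_score famQ C2Q ab abD p0.
have [mQ _ _] := Q_density famQ abD p0.
have iI := integrable_mul_score2 mD famQ C2Q ab abD T1 sT (Q_integrable famQ abD p0) p0.
have mI := measurable_int mu iI.
have E0 : (\int[mu]_(x in D) `|(Q x phi0 * s x phi0 ^+ 2)%:E| = 0)%E.
  rewrite -[RHS]/(0%:E) -I00 /Rintegral fineK; last exact: integrable_fin_num.
  apply: eq_integral => x /set_mem Dx; rewrite gee0_abs// lee_fin.
  by rewrite mulr_ge0 ?sqr_ge0// ltW// (Q_gt0 famQ abD Dx p0).
have /(ae_eq_integral_abs mu mD mI) ae0 := E0.
rewrite /Rintegral (_ : integral _ _ _ = 0%E)//.
rewrite -[RHS](integral0 mu D); apply: ae_eq_integral => //.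
- by apply/measurable_EFinP; apply: measurable_funM => //; exact: measurable_funM.
- apply: filterS ae0 => x /= sx0 Dx; move: (sx0 Dx) => /= [] /eqP.
  rewrite mulf_eq0 gt_eqF ?(Q_gt0 famQ abD Dx p0)//= sqrf_eq0 => /eqP ->.
  by rewrite mul0r mulr0.
Qed.

Lemma minimizer_expansion : Dphi phi0 ->
  has_ubound [set `|s x phi0| | x in D] ->
  (exists K : R, \forall phi \near within Dphi (nbhs phi0),
     forall x, D x -> `|ds x phi| <= K) ->
  exists C delta : R, 0 < delta /\ forall P h phis,
    mdensity mu D P -> (forall x, D x -> P x = Q x phi0 + h x) ->
    L1 h < delta ->
    unique_minimizer Dphi (divergence mu D P Q) phis -> Dphi° phis ->
    segment phis phi0 `<=` Dphi ->
    (forall phi, segment phis phi0 phi ->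
       second_derivative_gt0 Dphi (divergence mu D P Q) phi) ->
    minimizer_bounds C P h phis.
Proof.
move=> Dphi0 ubs [K0 nearK].
have [r0 r00 r0K] : exists2 r, 0 < r & forall x t, `|t - phi0| < r -> Dphi t ->
    D x -> `|ds x t| <= `|K0|.
  move: nearK; rewrite near_withinE => /nbhs_ballP[r /= r0 rK]; exists r => //.
  move=> x t tr Dt Dx; apply: le_trans (ler_norm K0); apply: rK => //.
  by rewrite /ball /= distrC.
pose S := sup [set `|s x phi0| | x in D].
have sS x : D x -> `|s x phi0| <= S.
  by move=> Dx; apply: ub_le_sup => //; exists x.
pose T := 1 + `|S| + `|K0|.
have T1 : 1 <= T by rewrite /T -addrA lerDl addr_ge0.
have T0 : 0 < T := lt_le_trans ltr01 T1.
have I00 : 0 <= I0.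
  apply: Rintegral_ge0 => x Dx; rewrite mulr_ge0 ?sqr_ge0// ltW//.
  by have [_] := famQ Dphi0; exact.
(* The bound [r0 / 2] stays where the derivative of the score is bounded, [(4 * T)^-1] yields [Tab]
   for an interval of length [2 * r], and the last one makes the quadratic error small against [I0].
   The value 1 is a placeholder for [I0 = 0]. *)
pose r := Num.min (r0 / 2) (Num.min (4 * T)^-1
  (if I0 == 0 then 1 else I0 / (16 * T ^+ 3))).
have rp : 0 < r.
  rewrite !lt_min divr_gt0// invr_gt0 mulr_gt0//=.
  by case: eqVneq => // I0n; rewrite divr_gt0 ?mulr_gt0 ?exprn_gt0// lt0r I0n.
have rr0 : r < r0.
  by apply: (@le_lt_trans _ _ (r0 / 2)); [rewrite /r ge_min lexx|lra].
have rT : 4 * T * r <= 1.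
  rewrite mulrC -ler_pdivlMr ?mulr_gt0// div1r /r !ge_min lexx orbT//.
have r4 : r <= 4^-1.
  have : 4 * r <= 1 by apply: le_trans rT; rewrite ler_wpM2r ?(ltW rp)// ler_peMr.
  lra.
have rI : 0 < I0 -> 16 * T ^+ 3 * r <= I0.
  move=> I0p; rewrite mulrC -ler_pdivlMr ?mulr_gt0 ?exprn_gt0//.
  by rewrite /r !ge_min (gt_eqF I0p) lexx !orbT.
pose C := (16 * T ^+ 5 / I0 ^+ 2 + 2 * T ^+ 2 / I0) / I0 +
     4 * (4 * T ^+ 3 / I0 + T ^+ 2 + 3 * (12 * T ^+ 4 / I0 + T)) / I0 ^+ 2.
(* Both witnesses are fixed before [P], [h] and [phis], which makes the O-terms uniform. This
   [delta] gives [T * n <= r * I0 / 4]. *)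
exists C, (if I0 == 0 then 1 else r * I0 / (4 * T)); split.
  by case: eqVneq => // I0n; rewrite divr_gt0 ?mulr_gt0// lt0r I0n.
move=> P h phis dP hP hdelta minF intF segD F2.
have [A [B [[/andP[Aphis phisB] /andP[Aphi0 phi0B]] ABD FAB G0 Gmono]]] :=
  unique_minimizer_neighborhood minF intF segD F2.
(* The interval [[A, B]] depends on [P]; cutting it to distance [r] from [phi0] makes the bounds
   depend on the model only. *)
pose a := Num.max A (phi0 - r); pose b := Num.min B (phi0 + r).
have abE t : (t \in `[a, b]) = (A <= t <= B) && (phi0 - r <= t <= phi0 + r).
  by rewrite in_itv/= /a /b ge_max le_min andbACA.
have ab : a < b.
  by rewrite /a /b gt_max !lt_min; apply/and3P; split; try (apply/andP; split);
    clear -Aphis phisB Aphi0 phi0B rp; lra.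
have abr t : t \in `[a, b] -> `|t - phi0| <= r.
  by rewrite abE ler_distl => /andP[].
have abAB t : t \in `[a, b] -> t \in `[A, B].
  by rewrite abE in_itv => /andP[].
have abD : `[a, b] `<=` Dphi by move=> t /abAB; exact: ABD.
have p0 : phi0 \in `[a, b] by rewrite abE Aphi0 phi0B/=; lra.
have ba : b - a <= 2 * r.
  have : b <= phi0 + r by rewrite /b ge_min lexx orbT.
  have : phi0 - r <= a by rewrite /a le_max lexx orbT.
  lra.
have Tab : 2 * T * (b - a) <= 1.
  apply: le_trans rT; have -> : 4 * T * r = 2 * T * (2 * r) by ring.
  by rewrite ler_wpM2l// mulr_ge0// ltW.
have dsK x t : D x -> t \in `[a, b] -> `|ds x t| <= `|K0|.
  move=> Dx tab; apply: r0K (abD _ tab) Dx; apply: le_lt_trans rr0.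
  exact: abr.
have sT x t : D x -> t \in `[a, b] -> `|s x t| <= T.
  move=> Dx tab; apply: (@le_trans _ _ (S + `|K0|)); last first.
    by rewrite /T lerD2r; have := ler_norm S; lra.
  by apply: (local_score_bound p0 abD) => //; lra.
have dsT x t : D x -> t \in `[a, b] -> `|ds x t| <= T.
  by move=> Dx /(dsK x _ Dx)/le_trans; apply; rewrite /T; have := normr_ge0 S; lra.
have GE t : t \in `[a, b] -> derive_in Dphi (fine \o divergence mu D P Q) t =
    - \int[mu]_(x in D) (P x * s x t).
  move=> tab; apply: (KL_derive mD famQ C2Q ab abD T1 sT dsT dP) => //.
  - by move=> u /abAB /FAB[].
  - by have [] := FAB t (abAB _ tab).
pose n := L1 h.
have n0 : 0 <= n by exact: Rintegral_ge0.
pose H := \int[mu]_(x in D) (h x * s x phi0).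
have HS : `|H| <= S * n.
  apply: (deviation_bound mD famQ abD p0 dP hP) sS.
  exact: (measurable_score famQ C2Q ab abD p0).
have [I0z|I0n] := eqVneq I0 0.
  (* The score vanishes almost everywhere, so [phis = phi0], and all the terms
     vanish because [0^-1 = 0]. *)
  have ms0 := measurable_score famQ C2Q ab abD p0.
  have m1 : measurable_fun D (fun=> 1 : R) by exact: measurable_cst.
  have phisE : phis = phi0.
    have G1 : derive_in Dphi (fine \o divergence mu D P Q) phi0 = 0.
      rewrite GE// -[RHS]oppr0; congr (- _).
      rewrite -[RHS](fisher_eq0 p0 ab abD T1 sT dP m1 I0z).
      by apply: eq_Rintegral => x _; rewrite mulr1.
    have s1 : segment phis phi0 phis by rewrite /segment /= ge_min le_max lexx.
    have s2 : segment phis phi0 phi0 by rewrite /segment /= ge_min le_max lexx !orbT.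
    have [/(Gmono _ _ s1 s2)|/(Gmono _ _ s2 s1)|//] := ltgtP phis phi0;
      by rewrite G0 G1 ltxx.
  have N0 : \int[mu]_(x in D) (P x * s x phi0 ^+ 2) = 0.
    rewrite -[RHS](fisher_eq0 p0 ab abD T1 sT dP ms0 I0z).
    by apply: eq_Rintegral => x _; rewrite expr2.
  rewrite /minimizer_bounds phisE N0 /C I0z subrr expr0n !invr0 !mulr0 !addr0 !mul0r.
  by split; rewrite ?normr0 ?subr0 ?normr0 ?addr0.
have I0p : 0 < I0 by rewrite lt0r I0n.
rewrite (negbTE I0n) -/n in hdelta.
have Tn : T * n <= r * I0 / 4.
  move: hdelta; rewrite invfM mulrA ltr_pdivlMr// => /ltW; lra.
have ST : S <= T by rewrite /T; have := ler_norm S; have := normr_ge0 K0; lra.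
have HT : `|H| <= T * n by apply: le_trans HS _; exact: ler_wpM2r.
have key t : t \in `[a, b] ->
    `|\int[mu]_(x in D) (P x * s x t) - H + (t - phi0) * I0|
    <= 4 * T ^+ 3 * (t - phi0) ^+ 2 + T * `|t - phi0| * n.
  exact: (perturbed_score_mean mD famQ C2Q ab abD T1 Tab sT dsT p0 dP hP).
(* Within distance [r] each of the two error terms is at most a quarter of [|t - phi0| * I0]. *)
have key' t : t \in `[a, b] ->
    `|\int[mu]_(x in D) (P x * s x t) - H + (t - phi0) * I0|
    <= `|t - phi0| * I0 / 2.
  move=> tab; apply: le_trans (key t tab) _.
  have tr := abr _ tab.
  rewrite -(real_normK (num_real (t - phi0))).
  move: `|t - phi0| (normr_ge0 (t - phi0)) tr => e e0 er.
  have H1 : 4 * T ^+ 3 * e <= I0 / 4.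
    have : 16 * T ^+ 3 * e <= 16 * T ^+ 3 * r.
      by rewrite ler_wpM2l// mulr_ge0// exprn_ge0// ltW.
    have := rI I0p; clear; lra.
  have H2 : T * n <= I0 / 4.
    apply: le_trans Tn _; have : r * I0 <= 1 * I0.
      by rewrite ler_wpM2r//; clear -r4; lra.
    clear -I0p; lra.
  have -> : 4 * T ^+ 3 * e ^+ 2 + T * e * n = (4 * T ^+ 3 * e + T * n) * e by ring.
  by rewrite [e * I0]mulrC [leRHS]mulrAC ler_wpM2r//; clear -H1 H2; lra.
(* At distance [r] the main term is [r * I0] in size, and [H] and the error take at most three
   quarters of it, so its sign prevails. *)
have Hle : - (r * I0 / 4) <= H <= r * I0 / 4.
  by rewrite -ler_norml (le_trans HT).
have rI0 : 0 < r * I0 by rewrite mulr_gt0.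
(* If [phis] were farther than [r] from [phi0], the derivative of the divergence
   at [phi0 - r] or [phi0 + r] would have the wrong sign. *)
have phisab : phis \in `[a, b].
  rewrite abE (ltW Aphis) (ltW phisB) !leNgt /=; apply/andP; split; apply/negP => L.
  - have tab : phi0 - r \in `[a, b] by rewrite abE; clear -L rp Aphis phi0B; lra.
    have := key' _ tab; have : 0 < - \int[mu]_(x in D) (P x * s x (phi0 - r)).
      rewrite -GE// -G0; apply: Gmono => //.
        by rewrite /segment /= ge_min le_max lexx.
      by rewrite /segment /= ge_min le_max; clear -L rp; lra.
    have -> : phi0 - r - phi0 = - r by ring.
    rewrite normrN (gtr0_norm rp) ler_norml mulNr.
    move: (Rintegral _ _ _) => v v0 /andP[+ _]; clear -v0 Hle rI0; lra.
  - have tab : phi0 + r \in `[a, b] by rewrite abE; clear -L rp phisB Aphi0; lra.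
    have := key' _ tab; have : - (\int[mu]_(x in D) (P x * s x (phi0 + r))) < 0.
      rewrite -GE// -G0; apply: Gmono => //.
        by rewrite /segment /= ge_min le_max; clear -L rp; lra.
      by rewrite /segment /= ge_min le_max lexx.
    have -> : phi0 + r - phi0 = r by ring.
    rewrite (gtr0_norm rp) ler_norml.
    move: (Rintegral _ _ _) => v v0 /andP[_]; clear -v0 Hle rI0; lra.
have Ps0 : \int[mu]_(x in D) (P x * s x phis) = 0.
  by apply/eqP; rewrite -oppr_eq0 -GE// G0.
have dr := abr _ phisab.
(* As the mean score under [P] vanishes at [phis], only the bias times [I0] minus [H] is left. *)
have kphis := key _ phisab; rewrite Ps0 sub0r addrC in kphis.
(* With both terms below [I0 / 16], the coefficients 6 and 1 add up to [7 / 16] of [I0], within the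
   required half. *)
have Td : T ^+ 3 * `|phis - phi0| <= I0 / 16.
  have : T ^+ 3 * `|phis - phi0| <= T ^+ 3 * r.
    by rewrite ler_wpM2l// exprn_ge0// ltW.
  have := rI I0p; clear; lra.
have Tn' : T * n <= I0 / 16.
  have : r * I0 <= 4^-1 * I0 by rewrite ler_wpM2r// ltW.
  clear -Tn; lra.
have [||B1 B2] := expansion_estimates I0p T1 n0 _ HT kphis
  (perturbed_score2_mean mD famQ C2Q ab abD T1 sT dsT p0 dP hP phisab)
  (perturbed_dscore_mean mD famQ C2Q ab abD T1 Tab sT dsT p0 dP hP phisab).
- by rewrite -mulrA; clear -Td Tn' I0p; lra.
- by rewrite -mulrA; clear -Td Tn' I0p; lra.
have B1' : `| `|phi0 - phis| - `|H / I0| | <= C * n ^+ 2.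
  by rewrite (distrC phi0); apply: le_trans (ler_dist_dist _ _) _; exact: B1.
split => //.
(* Here [H] is bounded with the exact supremum [S] instead of the cruder [T], as the leading term of
   the second estimate demands. *)
have HI : `|H / I0| <= n * (S / I0).
  rewrite normrM normfV (gtr0_norm I0p) mulrA ler_wpM2r ?invr_ge0 ?(ltW I0p)//.
  by rewrite mulrC.
apply: (@le_trans _ _ (`|H / I0| + C * n ^+ 2)); last by rewrite lerD2r.
by move: B1'; rewrite ler_norml => /andP[_]; rewrite lerBlDl.
Qed.

End minimizer_expansion.

(** * Specialization to Lebesgue measure and passage to the limiting mean and variance *)

Theorem lemma18 (R : realType) (D Dphi : set R) (Q : R -> R -> R) (phi0 : R)
  (mD : measurable D)
  (Q_family : density_family D Dphi Q)
  (logQ_C2 : forall x, D x -> C2_in Dphi (fun phi => ln (Q x phi)))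
  (phi0_Dphi : Dphi phi0)
  (score_bounded : has_ubound [set `|score Dphi Q x phi0| | x in D])
  (dscore_bounded : exists K : R, \forall phi \near within Dphi (nbhs phi0),
     forall x, D x -> `|dscore Dphi Q x phi| <= K) :
  exists C delta : R, 0 < delta /\
  forall (P h : R -> R) (phis : R),
    density D P ->
    (forall x, D x -> P x = Q x phi0 + h x) ->
    norm1 D h < delta ->
    (forall phi, Dphi phi ->
       expectation_exists D P (fun x => score Dphi Q x phi) /\
       expectation_exists D P (fun x => dscore Dphi Q x phi)) ->
    unique_minimizer Dphi (KL D P Q) phis ->
    Dphi° phis ->
    segment phis phi0 `<=` Dphi ->
    (forall phi, segment phis phi0 phi ->
       second_derivative_gt0 Dphi (KL D P Q) phi) ->
    bias_variance_bounds D Dphi Q phi0 h C phis (eps2 D Dphi Q P phis) /\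
    forall (d : measure_display) (Omega : measurableType d)
      (Pr : probability Omega R) (X est : nat -> {RV Pr >-> R}),
      moment_projection_estimator D Dphi Q P X est ->
      ('E_Pr[est M])%E @[M --> \oo] --> phis%:E ->
      (M%:R%:E * 'V_Pr[est M])%E @[M --> \oo] --> (eps2 D Dphi Q P phis)%:E ->
      bias_variance_bounds D Dphi Q phi0 h C
        (fine (limn (fun M => 'E_Pr[est M])%E))
        (fine (limn (fun M => M%:R%:E * 'V_Pr[est M])%E)).
Proof.
have [C [delta [delta0 HC]]] :=
  @minimizer_expansion _ (measurableTypeR R) R lebesgue_measure D Dphi Q phi0
    mD Q_family logQ_C2 phi0_Dphi score_bounded dscore_bounded.
exists C, delta; split=> // P h phis dP hP hdelta _ minF intF segD F2.
have bounds : bias_variance_bounds D Dphi Q phi0 h C phis (eps2 D Dphi Q P phis).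
  exact: HC dP hP hdelta minF intF segD F2.
split=> // d Omega Pr X est _ limE limV.
by rewrite (cvg_lim _ limE)// (cvg_lim _ limV).
Qed.
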